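(* Let $\mathcal{S}=\overline{\mathbb{Z}}_{\max}[\![\gamma]\!]$, and let $A\in\mathcal{S}^{n\times n}$, $B\in\mathcal{S}^{n\times p}$, $C\in\mathcal{S}^{m\times n}$, $R\in\mathcal{S}^{n\times l}$ be the matrices of a system satisfying the standing assumptions in the context. For $u\in\mathcal{S}^p$ and $w\in\mathcal{S}^l$ let $x=A^\ast Bu\oplus A^\ast Rw$ be the state, i.e. the least solution of $x=Ax\oplus Bu\oplus Rw$, and let $y=Cx$. For $L\in\mathcal{S}^{n\times m}$ let $\hat{x}$ be the estimated state, i.e. the least solution of $$\hat{x}=A\hat{x}\oplus Bu\oplus L(\hat{y}\oplus y),\qquad \hat{y}=C\hat{x}.$$ Put $$L_1=(A^\ast B)/(CA^\ast B),\qquad L_2=(A^\ast R)/(CA^\ast R),\qquad L_x=L_1\wedge L_2 .$$ Then $L_x$ is the greatest matrix $L\in\mathcal{S}^{n\times m}$ such that $\hat{x}\preceq x$ for all $(u,w)\in\mathcal{S}^p\times\mathcal{S}^l$.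
   Context: Idempotent semiring. $\overline{\mathbb{Z}}_{\max}=\mathbb{Z}\cup\{-\infty,+\infty\}$ with $\oplus=\max$ and $\otimes=+$ (and $(-\infty)+(+\infty)=-\infty$). $\mathcal{S}=\overline{\mathbb{Z}}_{\max}[\![\gamma]\!]$ is the set of formal series $s=\bigoplus_{k\in\mathbb{Z}}s(k)\gamma^k$, $s(k)\in\overline{\mathbb{Z}}_{\max}$, with coefficientwise sum and Cauchy product, subject to the rule $t\gamma^{n_1}\oplus t\gamma^{n_2}=t\gamma^{\min(n_1,n_2)}$ (i.e. a series is identified with the series with nondecreasing coefficients $k\mapsto\sup_{j\le k}s(j)$). It is a complete idempotent semiring (closed under infinite $\oplus$-sums, over which $\otimes$ distributes) with zero $\varepsilon$ (absorbing) and unit $e=0\gamma^0$. Order: $a\succeq b\iff a=a\oplus b$; $\wedge$ is the greatest lower bound. $\otimes$ is often omitted. Matrices. Sum, product, order and $\wedge$ of matrices are the usual ones built from the scalar ones (sum, order and $\wedge$ are entrywise); $e$ also denotes the identity matrix. For a square matrix $M$, $M^\ast=\bigoplus_{i\in\mathbb{N}}M^i$ with $M^0=e$; the least solution of $x=Mx\oplus b$ is $M^\ast b$. For matrices $P\in\mathcal{S}^{n\times q}$ and $Q\in\mathcal{S}^{m\times q}$, $P/Q\in\mathcal{S}^{n\times m}$ denotes the greatest matrix $X$ with $XQ\preceq P$ (right residuation). Standing assumptions on the system. Each column of $B$ (resp. $R$) has exactly one entry equal to $e$, the others being $\varepsilon$, and each row has at most one entry equal to $e$. Each row of $C$ has exactly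 one entry equal to $e$, the others being $\varepsilon$, and each column has at most one entry equal to $e$. *)

(* Defs.v *)
From HB Require Import structures.
From mathcomp Require Import all_boot all_order all_algebra.
From mathcomp Require Import boolp classical_sets constructive_ereal.

Set Implicit Arguments.
Unset Strict Implicit.
Unset Printing Implicit Defensive.

Import Order.TTheory GRing.Theory Num.Theory.
Local Open Scope classical_set_scope.
Local Open Scope ring_scope.

(* The coefficient semiring is [\bar int]: its oplus is [Order.max], its      *)
(* otimes is the addition [+%E], for which (-oo) + (+oo) = -oo.               *)

Definition zsup (A : set (\bar int)) : \bar int := supremum -oo%E A.

Lemma zsup_spec (A : set (\bar int)) :
  ubound A (zsup A) /\ forall b, ubound A b -> (zsup A <= b)%E.
Proof.
case: (pselect (exists m, supremums A m)) => [[m mA]|noA]; last first.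
  exfalso; apply: noA.
  case: (pselect (A +oo%E)) => [Ay|Ny].
    by exists +oo%E; split=> [x _|b]; [rewrite leey|apply].
  case: (pselect (exists r : int, A r%:E)) => [[r Ar]|Nfin]; last first.
    exists -oo%E; split=> [[r||] Ax|b _]; rewrite ?leNye //.
    by case: Nfin; exists r.
  case: (pselect (exists b : int, ubound A b%:E)) => [[b bA]|Nbnd]; last first.
    exists +oo%E; split=> [x _|[b||] bA]; rewrite ?leey //.
      by case: Nbnd; exists b.
    by have := bA _ Ar.
  have exn : exists n : nat, `[< A (b - n%:Z)%:E >].
    have rb : r <= b by have := bA _ Ar; rewrite lee_fin.
    exists `|b - r|%N; apply/asboolP.
    by rewrite gez0_abs ?subr_ge0 // opprB addrC subrK.
  case: (ex_minnP exn) => n /asboolP An nmin.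
  exists (b - n%:Z)%:E; split=> [[s||] As|c]; rewrite ?leNye //; last exact.
  have sb : s <= b by have := bA _ As; rewrite lee_fin.
  have /nmin : `[< A (b - `|b - s|%N%:Z)%:E >].
    by apply/asboolP; rewrite gez0_abs ?subr_ge0 // opprB addrC subrK.
  rewrite lee_fin -lez_nat gez0_abs ?subr_ge0 // => ?.
  by rewrite lerBrDr -lerBrDl.
rewrite /zsup /supremum; case: ifPn => [/eqP->|_].
  by split=> [x []|b _]; rewrite leNye.
by have [] := xgetI (-oo)%E mA.
Qed.

Lemma zsup_ub (A : set (\bar int)) x : A x -> (x <= zsup A)%E.
Proof. exact: (proj1 (zsup_spec A)). Qed.

Lemma zsup_le (A : set (\bar int)) b : ubound A b -> (zsup A <= b)%E.
Proof. exact: (proj2 (zsup_spec A)). Qed.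

Lemma adde_zsup_le a (A : set (\bar int)) b :
  (forall x, A x -> (a + x <= b)%E) -> (a + zsup A <= b)%E.
Proof.
case: a => [r||] le_b.
- have rfin : r%:E \is a fin_num by [].
  rewrite -leeBrDl //; apply: zsup_le => x Ax.
  by rewrite leeBrDl //; exact: le_b.
- have [->|zA] := eqVneq (zsup A) -oo%E; first by rewrite addeNy leNye.
  have [x Ax xN] : exists2 x, A x & x != -oo%E.
    apply: contrapT => noA; case/negP: zA; rewrite -leeNy_eq.
    apply: zsup_le => x Ax; rewrite leeNy_eq; apply: contrapT => /negP xN.
    by apply: noA; exists x.
  by have := le_b _ Ax; rewrite !addye.
- by rewrite addNye leNye.
Qed.

(* The rule t gamma^n1 (+) t gamma^n2 = t gamma^(min n1 n2) identifies a      *)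
(* series s with the nondecreasing one k |-> sup_(j <= k) s(j), which is      *)
(* computed by [gseries_of]; a [gseries] is such a canonical representative.  *)
Record gseries := GSeries {
  coef :> int -> \bar int;
  coef_homo : {homo coef : i j / (i <= j)%O} }.

HB.instance Definition _ := gen_eqMixin gseries.
HB.instance Definition _ := gen_choiceMixin gseries.

Lemma gseriesP (s t : gseries) : (forall k, s k = t k) -> s = t.
Proof.
case: s t => [s hs] [t ht] /= /funext st; case: _ / st in ht *.
by congr GSeries; exact: Prop_irrelevance.
Qed.

Lemma gseries_of_homo (f : int -> \bar int) :
  {homo (fun k : int => zsup [set f j | j in [set j | j <= k]])
    : i j / (i <= j)%O}.
Proof.
move=> i j ij; apply: zsup_le => _ [k /= ki <-]; apply: zsup_ub.
by exists k => //=; exact: le_trans ij.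
Qed.
Definition gseries_of f := GSeries (gseries_of_homo f).

(* The coefficientwise operations and the Cauchy product of nondecreasing     *)
(* series are nondecreasing; [gseries_of_add] and [gseries_of_mul] below show *)
(* that they do not depend on the representatives of the two series.          *)
Lemma szero_homo : {homo (fun _ : int => -oo%E : \bar int) : i j / (i <= j)%O}.
Proof. by []. Qed.
Definition szero := GSeries szero_homo.

Definition sone := gseries_of (fun k : int => if k == 0 then 0%E else -oo%E).

Lemma sadd_homo (s t : gseries) :
  {homo (fun k : int => Order.max (s k) (t k)) : i j / (i <= j)%O}.
Proof. by move=> i j ij; rewrite ge_max !le_max !coef_homo ?orbT. Qed.
Definition sadd s t := GSeries (sadd_homo s t).

Lemma smeet_homo (s t : gseries) :
  {homo (fun k : int => Order.min (s k) (t k)) : i j / (i <= j)%O}.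
Proof. by move=> i j ij; rewrite le_min !ge_min !coef_homo ?orbT. Qed.
Definition smeet s t := GSeries (smeet_homo s t).

Lemma smul_homo (s t : gseries) :
  {homo (fun k : int => zsup (range (fun i : int => (s i + t (k - i)%R)%E)))
    : i j / (i <= j)%O}.
Proof.
move=> i j ij; apply: zsup_le => _ [h _ <-].
apply: (@le_trans _ _ (s h + t (j - h)%R)%E).
  by apply: leeD2l; apply: coef_homo; rewrite lerD2r.
by apply: zsup_ub; exists h.
Qed.
Definition smul s t := GSeries (smul_homo s t).

Lemma ssum_homo (F : set gseries) :
  {homo (fun k : int => zsup [set s k | s in F])
    : i j / (i <= j)%O}.
Proof.
move=> i j ij; apply: zsup_le => _ [s Fs <-].
by apply: (le_trans (coef_homo s ij)); apply: zsup_ub; exists s.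
Qed.
Definition ssum F := GSeries (ssum_homo F).

Lemma saddA : associative sadd.
Proof. by move=> s t u; apply: gseriesP => k /=; rewrite maxA. Qed.
Lemma saddC : commutative sadd.
Proof. by move=> s t; apply: gseriesP => k /=; rewrite maxC. Qed.
Lemma sadd0 : left_id szero sadd.
Proof.
by move=> s; apply: gseriesP => k /=; apply/max_idPr; rewrite leNye.
Qed.

HB.instance Definition _ := GRing.isNmodule.Build gseries saddA saddC sadd0.

Lemma smulC : commutative smul.
Proof.
suff le s t k : (smul s t k <= smul t s k)%E.
  by move=> s t; apply: gseriesP => k; apply: le_anti; rewrite !le.
apply: zsup_le => _ [i _ <-]; apply: zsup_ub; exists (k - i) => //.
by rewrite addeC subKr.
Qed.

Lemma smulA : associative smul.
Proof.
have le s t u k : (smul s (smul t u) k <= smul (smul s t) u k)%E.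
  apply: zsup_le => _ [i _ <-] /=; apply: adde_zsup_le => _ [j _ <-].
  rewrite addeA; apply: (@le_trans _ _ (smul s t (i + j)%R + u (k - i - j)%R)%E).
    apply: leeD2r; apply: zsup_ub; exists i => //.
    by rewrite [i + j]addrC addrK.
  by apply: zsup_ub; exists (i + j) => //; rewrite opprD addrA.
move=> s t u; apply: gseriesP => k; apply: le_anti; rewrite le andTb.
rewrite (smulC (smul s t)) (smulC s t) (smulC s) (smulC t u).
exact: le.
Qed.

Lemma smul1 : left_id sone smul.
Proof.
move=> s; apply: gseriesP => k; apply: le_anti; apply/andP; split.
  apply: zsup_le => _ [i _ <-] /=; rewrite addeC.
  apply: adde_zsup_le => _ [j /= ji <-]; case: eqP => [j0|_]; last first.
    by rewrite addeNy leNye.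
  by rewrite adde0; apply: coef_homo; rewrite gerBl -j0.
apply: zsup_ub; exists 0 => //; rewrite subr0.
suff -> : sone 0 = 0%E by rewrite add0e.
apply: le_anti; apply/andP; split.
  by apply: zsup_le => _ [j _ <-]; case: eqP => // _; rewrite leNye.
by apply: zsup_ub; exists 0.
Qed.

Lemma smul0 : left_zero szero smul.
Proof.
move=> s; apply: gseriesP => k; apply: le_anti; apply/andP; split.
  by apply: zsup_le => _ [i _ <-].
by rewrite leNye.
Qed.

Lemma smulDl : left_distributive smul sadd.
Proof.
move=> s t u; apply: gseriesP => k; apply: le_anti; apply/andP; split.
  apply: zsup_le => _ [i _ <-] /=; rewrite le_max.
  case: (leP (s i) (t i)) => _; apply/orP; [right|left];
    by apply: zsup_ub; exists i.
rewrite /= ge_max; apply/andP; split; apply: zsup_le => _ [i _ <-].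
  apply: (@le_trans _ _ (sadd s t i + u (k - i)%R)%E); last first.
    by apply: zsup_ub; exists i.
  by apply: leeD2r; rewrite /= le_max lexx.
apply: (@le_trans _ _ (sadd s t i + u (k - i)%R)%E); last first.
  by apply: zsup_ub; exists i.
by apply: leeD2r; rewrite /= le_max lexx orbT.
Qed.

Lemma sone_neq0 : sone != szero.
Proof.
apply/eqP => /(congr1 (fun s : gseries => s 0)) /= s0.
have : (0%:E <= -oo :> \bar int)%E by rewrite -s0; apply: zsup_ub; exists 0.
by [].
Qed.

HB.instance Definition _ := GRing.Nmodule_isComNzSemiRing.Build gseries
  smulA smulC smul1 smulDl smul0 sone_neq0.

Lemma saddE (s t : gseries) k : (s + t) k = Order.max (s k) (t k).
Proof. by []. Qed.

Lemma gseries_of_add (f g : int -> \bar int) :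
  gseries_of (fun k : int => Order.max (f k) (g k)) =
  gseries_of f + gseries_of g.
Proof.
apply: gseriesP => k; rewrite saddE; apply: le_anti; apply/andP; split.
  apply: zsup_le => _ [j /= jk <-]; rewrite ge_max !le_max.
  by apply/andP; split; apply/orP; [left|right]; apply: zsup_ub; exists j.
rewrite ge_max; apply/andP; split; apply: zsup_le => _ [j /= jk <-];
  apply: (@le_trans _ _ (Order.max (f j) (g j)));
  by [rewrite le_max lexx ?orbT | apply: zsup_ub; exists j].
Qed.

Lemma gseries_of_mul (f g : int -> \bar int) :
  gseries_of (fun k : int => zsup (range (fun i : int => (f i + g (k - i)%R)%E))) =
  gseries_of f * gseries_of g.
Proof.
apply: gseriesP => k; apply: le_anti; apply/andP; split.
  apply: zsup_le => _ [j /= jk <-]; apply: zsup_le => _ [i _ <-].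
  apply: (@le_trans _ _ (gseries_of f i + gseries_of g (k - i)%R)%E); last first.
    by apply: zsup_ub; exists i.
  apply: leeD; apply: zsup_ub; first by exists i => //=.
  by exists (j - i) => //=; rewrite lerD2r.
apply: zsup_le => _ [i _ <-]; apply: adde_zsup_le => _ [b /= bk <-].
rewrite addeC; apply: adde_zsup_le => _ [a /= ai <-]; rewrite addeC.
apply: (@le_trans _ _ (zsup (range (fun h : int => (f h + g (a + b - h)%R)%E)))).
  by apply: zsup_ub; exists a => //; rewrite [a + b]addrC addrK.
apply: zsup_ub; exists (a + b) => //=.
by rewrite -(subrK i k) [k - i + i]addrC lerD.
Qed.

Fact gseries_display : Order.disp_t. Proof. exact: Order.Disp tt tt. Qed.

Definition sle (s t : gseries) := s + t == t.

Lemma sleP (s t : gseries) : reflect (forall k, (s k <= t k)%E) (sle s t).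
Proof.
apply: (iffP eqP) => [st k|st].
  by rewrite -st saddE le_max lexx.
by apply: gseriesP => k; rewrite saddE; apply/max_idPr.
Qed.

Lemma sle_refl : reflexive sle.
Proof. by move=> s; apply/sleP. Qed.
Lemma sle_anti : antisymmetric sle.
Proof.
move=> s t /andP[/sleP st /sleP ts]; apply: gseriesP => k.
by apply: le_anti; rewrite st ts.
Qed.
Lemma sle_trans : transitive sle.
Proof.
move=> t s u /sleP st /sleP tu; apply/sleP => k; exact: le_trans (tu k).
Qed.

HB.instance Definition _ := Order.Le_isPOrder.Build gseries_display gseries
  sle_refl sle_anti sle_trans.

Lemma sleE (s t : gseries) : (s <= t)%O = (s + t == t).
Proof. by []. Qed.

Lemma sle_meet (s t u : gseries) :
  (s <= smeet t u)%O = (s <= t)%O && (s <= u)%O.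
Proof.
apply/sleP/andP => [h|[/sleP h1 /sleP h2] k /=]; last by rewrite le_min h1 h2.
by split; apply/sleP => k; have := h k; rewrite /= le_min => /andP[].
Qed.

Lemma sle_add (s t u : gseries) : (s + t <= u)%O = (s <= u)%O && (t <= u)%O.
Proof.
apply/sleP/andP => [h|[/sleP h1 /sleP h2] k]; last first.
  by rewrite saddE ge_max h1 h2.
by split; apply/sleP => k; have := h k; rewrite saddE ge_max => /andP[].
Qed.

HB.instance Definition _ := Order.POrder_isMeetSemilattice.Build
  gseries_display gseries sle_meet.
HB.instance Definition _ := Order.POrder_isJoinSemilattice.Build
  gseries_display gseries sle_add.

Lemma ssum_ub (F : set gseries) s : F s -> (s <= ssum F)%O.
Proof. by move=> Fs; apply/sleP => k; apply: zsup_ub; exists s. Qed.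

Lemma ssum_le (F : set gseries) b : ubound F b -> (ssum F <= b)%O.
Proof.
move=> Fb; apply/sleP => k; apply: zsup_le => _ [s Fs <-].
by have /sleP := Fb _ Fs.
Qed.

Lemma mulr_ssum_le a (F : set gseries) b :
  (forall s, F s -> (a * s <= b)%O) -> (a * ssum F <= b)%O.
Proof.
move=> Fb; apply/sleP => k; apply: zsup_le => _ [i _ <-] /=.
apply: adde_zsup_le => _ [s Fs <-]; have /sleP/(_ k) := Fb _ Fs.
by apply: le_trans; apply: zsup_ub; exists i.
Qed.

Lemma sum_le (I : finType) (f : I -> gseries) b :
  (\sum_i f i <= b)%O <-> forall i, (f i <= b)%O.
Proof.
split=> [h i|h]; first by move: h; rewrite (bigD1 i) //= sle_add => /andP[].
elim/big_ind: _ => // [|s t sb tb]; last by rewrite sle_add sb.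
by rewrite sleE add0r.
Qed.

Lemma smulr_le (a s t : gseries) : (s <= t)%O -> (a * s <= a * t)%O.
Proof. by rewrite !sleE -mulrDr => /eqP->. Qed.

Definition lemx m n (M N : 'M[gseries]_(m, n)) :=
  forall i j, (M i j <= N i j)%O.
Definition meetmx m n (M N : 'M[gseries]_(m, n)) : 'M[gseries]_(m, n) :=
  map2_mx Order.meet M N.

Definition is_greatest m n (E : set 'M[gseries]_(m, n)) M :=
  E M /\ forall N, E N -> lemx N M.
Definition is_least m n (E : set 'M[gseries]_(m, n)) M :=
  E M /\ forall N, E N -> lemx M N.

Definition star n (M : 'M[gseries]_n) : 'M[gseries]_n :=
  \matrix_(i, j) ssum (range (fun k => (M ^+ k) i j)).

(* P / Q; the default value of [xget] is never used, see [rdivmx_spec].       *)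
Definition rdivmx n m q (P : 'M[gseries]_(n, q)) (Q : 'M[gseries]_(m, q)) :
    'M[gseries]_(n, m) :=
  xget 0 (is_greatest [set X | lemx (X *m Q) P]).

Lemma lemx_refl m n (M : 'M[gseries]_(m, n)) : lemx M M.
Proof. by move=> i j. Qed.

Lemma lemx_trans m n (M N P : 'M[gseries]_(m, n)) :
  lemx M N -> lemx N P -> lemx M P.
Proof. by move=> h1 h2 i j; exact: le_trans (h1 i j) (h2 i j). Qed.

Lemma lemx_anti m n (M N : 'M[gseries]_(m, n)) :
  lemx M N -> lemx N M -> M = N.
Proof. by move=> h1 h2; apply/matrixP => i j; apply: le_anti; rewrite h1 h2. Qed.

Lemma lemxD m n (M N P : 'M[gseries]_(m, n)) :
  lemx (M + N) P <-> lemx M P /\ lemx N P.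
Proof.
split=> [h|[h1 h2] i j]; last by rewrite mxE sle_add h1 h2.
by split=> i j; have := h i j; rewrite mxE sle_add => /andP[].
Qed.

Lemma lemxM m n p (M : 'M[gseries]_(m, n)) (N P : 'M[gseries]_(n, p)) :
  lemx N P -> lemx (M *m N) (M *m P).
Proof.
move=> NP i j; rewrite !mxE; apply/sum_le => k.
apply: (le_trans (smulr_le _ (NP k j))).
by have /sum_le/(_ k) := lexx (\sum_k M i k * P k j).
Qed.

Lemma rdivmx_spec n m q (P : 'M[gseries]_(n, q)) (Q : 'M[gseries]_(m, q)) :
  is_greatest [set X | lemx (X *m Q) P] (rdivmx P Q).
Proof.
apply: xgetPex.
exists (\matrix_(i, j) ssum [set X i j | X in [set X | lemx (X *m Q) P]]).
split=> [i j|X XQ i j]; last by rewrite mxE; apply: ssum_ub; exists X.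
rewrite mxE; apply/sum_le => k; rewrite mxE mulrC.
apply: mulr_ssum_le => _ [X /= XQ <-]; rewrite mulrC.
by have := XQ i j; rewrite mxE => /sum_le/(_ k).
Qed.

Lemma star_least n q (M : 'M[gseries]_n) (b : 'M[gseries]_(n, q)) :
  is_least [set x | x = M *m x + b] (star M *m b).
Proof.
have powP k x : x = M *m x + b -> lemx (M ^+ k *m b) x.
  move=> xE; elim: k => [|k IH].
    rewrite expr0 [1]/(1%:M) mul1mx xE.
    by have /lemxD[] := lemx_refl (M *m x + b).
  rewrite exprS -[M * _]/(M *m _) -mulmxA [X in lemx _ X]xE.
  apply: lemx_trans (lemxM M IH) _.
  by have /lemxD[] := lemx_refl (M *m x + b).
have star_le x : (forall k, lemx (M ^+ k *m b) x) -> lemx (star M *m b) x.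
  move=> h i j; rewrite mxE; apply/sum_le => k; rewrite mxE mulrC.
  apply: mulr_ssum_le => _ [h' _ <-]; rewrite mulrC.
  by have := h h' i j; rewrite mxE => /sum_le/(_ k).
have pow_le k : lemx (M ^+ k *m b) (star M *m b).
  move=> i j; rewrite !mxE; apply/sum_le => h.
  apply: (@le_trans _ _ (star M i h * b h j)).
    rewrite ![_ * b h j]mulrC; apply: smulr_le; rewrite mxE.
    by apply: ssum_ub; exists k.
  by have /sum_le/(_ h) := lexx (\sum_h star M i h * b h j).
split=> [|x /= xE]; last by apply: star_le => k; exact: powP.
apply: lemx_anti.
  apply: star_le => -[|k].
    rewrite expr0 [1]/(1%:M) mul1mx.
    by have /lemxD[] := lemx_refl (M *m (star M *m b) + b).
  rewrite exprS -[M * _]/(M *m _) -mulmxA.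
  apply: lemx_trans (lemxM M (pow_le k)) _.
  by have /lemxD[] := lemx_refl (M *m (star M *m b) + b).
apply/lemxD; split; last first.
  by have := pow_le 0; rewrite expr0 [1]/(1%:M) mul1mx.
move=> i j; rewrite mxE; apply/sum_le => k.
rewrite [(star M *m b) k j]mxE mulr_sumr; apply/sum_le => h.
rewrite [star M k h]mxE mulrA mulrAC.
apply: mulr_ssum_le => _ [r _ <-]; rewrite mulrAC -mulrA.
apply: (@le_trans _ _ (M i k * (M ^+ r *m b) k j)).
  apply: smulr_le; rewrite mxE.
  by have /sum_le/(_ h) := lexx (\sum_h (M ^+ r) k h * b h j).
apply: (@le_trans _ _ ((M ^+ r.+1 *m b) i j)); last exact: pow_le.
rewrite exprS -[M * _]/(M *m _) -mulmxA [leRHS]mxE.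
by have /sum_le/(_ k) := lexx (\sum_k M i k * (M ^+ r *m b) k j).
Qed.

Definition state n p l (A : 'M[gseries]_n) (B : 'M[gseries]_(n, p))
    (R : 'M[gseries]_(n, l)) (u : 'cV[gseries]_p) (w : 'cV[gseries]_l) :
    'cV[gseries]_n :=
  star A *m B *m u + star A *m R *m w.

Lemma state_least n p l (A : 'M[gseries]_n) (B : 'M[gseries]_(n, p))
    (R : 'M[gseries]_(n, l)) (u : 'cV[gseries]_p) (w : 'cV[gseries]_l) :
  is_least [set x | x = A *m x + B *m u + R *m w] (state A B R u w).
Proof.
rewrite /state -!mulmxA -mulmxDr.
have [h1 h2] := star_least A (B *m u + R *m w).
split=> [|x /= xE]; first by rewrite /= -addrA; exact: h1.
by apply: h2; rewrite /= addrA.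
Qed.

Definition estimate_eq n p m (A : 'M[gseries]_n) (B : 'M[gseries]_(n, p))
    (C : 'M[gseries]_(m, n)) (L : 'M[gseries]_(n, m))
    (u : 'cV[gseries]_p) (y : 'cV[gseries]_m) (xh : 'cV[gseries]_n) : Prop :=
  let yh := C *m xh in xh = A *m xh + B *m u + L *m (yh + y).

(* The default value of [xget] is never used, see [estimate_least].           *)
Definition estimate n p m (A : 'M[gseries]_n) (B : 'M[gseries]_(n, p))
    (C : 'M[gseries]_(m, n)) (L : 'M[gseries]_(n, m))
    (u : 'cV[gseries]_p) (y : 'cV[gseries]_m) : 'cV[gseries]_n :=
  xget 0 (is_least (estimate_eq A B C L u y)).

Lemma estimate_least n p m (A : 'M[gseries]_n) (B : 'M[gseries]_(n, p))
    (C : 'M[gseries]_(m, n)) (L : 'M[gseries]_(n, m))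
    (u : 'cV[gseries]_p) (y : 'cV[gseries]_m) :
  is_least (estimate_eq A B C L u y) (estimate A B C L u y).
Proof.
apply: xgetPex; exists (star (A + L *m C) *m (B *m u + L *m y)).
suff -> : estimate_eq A B C L u y =
    [set x | x = (A + L *m C) *m x + (B *m u + L *m y)] by exact: star_least.
apply/seteqP; split=> x; rewrite /estimate_eq /= mulmxDl mulmxDr mulmxA;
  by rewrite -!addrA [B *m u + (_ + _)]addrCA.
Qed.

Definition col_selection m n (M : 'M[gseries]_(m, n)) : Prop :=
  (forall j, exists2 i, M i j = 1 & forall k, k != i -> M k j = 0) /\
  (forall i j1 j2, M i j1 = 1 -> M i j2 = 1 -> j1 = j2).

Definition row_selection m n (M : 'M[gseries]_(m, n)) : Prop :=
  (forall i, exists2 j, M i j = 1 & forall k, k != j -> M i k = 0) /\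
  (forall i1 i2 j, M i1 j = 1 -> M i2 j = 1 -> i1 = i2).

(* Main.v *)
Require Import Defs.
From mathcomp Require Import all_boot all_order all_algebra.
From mathcomp Require Import classical_sets.

Import Order.TTheory GRing.Theory.
Local Open Scope classical_set_scope.
Local Open Scope ring_scope.

(* A gain [L] satisfies the specification if and only if [L C x <= x] for     *)
(* every reachable state [x]: this inequality makes [x] a supersolution of    *)
(* the estimator equation, and conversely [L C x <= xhat]. Testing it on      *)
(* [u = 0] or [w = 0] and on unit vectors gives [L C A^* B <= A^* B] and      *)
(* [L C A^* R <= A^* R], which is [L <= L1] and [L <= L2] by residuation.     *)

(** [estimate_le_state] eliminates the estimator from the specification, [lemx_unit] passes from all
    inputs to matrices, and [lemx_rdiv] with [lemx_meet] turns the two inequalities into a bound by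
    [Lx]. Each passage is an equivalence, so the admissible gains are exactly those below [Lx]. *)

Lemma lemxE (m n : nat) (M N : 'M[gseries]_(m, n)) : lemx M N <-> M + N = N.
Proof.
split=> [MN|MN i j]; last by rewrite sleE -[in X in _ == X]MN mxE.
by apply/matrixP => i j; rewrite mxE; apply/eqP; rewrite -sleE.
Qed.

Lemma lemxMr (m n p : nat) (M N : 'M[gseries]_(m, n)) (P : 'M[gseries]_(n, p)) :
  lemx M N -> lemx (M *m P) (N *m P).
Proof. by move=> /lemxE MN; apply/lemxE; rewrite -mulmxDl MN. Qed.

Lemma lemxDl (m n : nat) (M N : 'M[gseries]_(m, n)) : lemx M (M + N).
Proof. by have /lemxD[] := lemx_refl (M + N). Qed.

Lemma lemxDr (m n : nat) (M N : 'M[gseries]_(m, n)) : lemx N (M + N).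
Proof. by have /lemxD[] := lemx_refl (M + N). Qed.

Lemma lemxDD (m n : nat) (M N P Q : 'M[gseries]_(m, n)) :
  lemx M P -> lemx N Q -> lemx (M + N) (P + Q).
Proof.
move=> MP NQ; apply/lemxD; split.
  exact: lemx_trans MP (lemxDl _ _ _ _).
exact: lemx_trans NQ (lemxDr _ _ _ _).
Qed.

Lemma lemx_meet (m n : nat) (M N P : 'M[gseries]_(m, n)) :
  lemx M (meetmx N P) <-> lemx M N /\ lemx M P.
Proof.
split=> [h|[MN MP] i j]; last by rewrite mxE lexI MN MP.
by split=> i j; have := h i j; rewrite mxE lexI => /andP[].
Qed.

(** The unit vector [delta_mx j 0] extracts column [j]. *)
Lemma lemx_unit (m n : nat) (M N : 'M[gseries]_(m, n)) :
  (forall u : 'cV_n, lemx (M *m u) (N *m u)) -> lemx M N.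
Proof.
by move=> MN i j; have := MN (delta_mx j 0) i 0; rewrite -!colE !mxE.
Qed.

Lemma lemx_rdiv (n m q : nat) (X : 'M[gseries]_(n, m)) (P : 'M[gseries]_(n, q))
    (Q : 'M[gseries]_(m, q)) :
  lemx X (rdivmx P Q) <-> lemx (X *m Q) P.
Proof.
have [PQ PQmax] := rdivmx_spec P Q.
by split=> [XPQ|]; [exact: lemx_trans (lemxMr _ _ _ _ _ _ XPQ) PQ | exact: PQmax].
Qed.

(* A supersolution [x] of [x = M x + b] is a solution of [x = M x + (b + x)]. *)
Lemma star_le_supersolution (n q : nat) (M : 'M[gseries]_n)
    (b x : 'M[gseries]_(n, q)) :
  lemx (M *m x + b) x -> lemx (star M *m b) x.
Proof.
move=> /lemxE sup; have [_ least] := star_least M (b + x).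
apply: lemx_trans (lemxM _ (lemxDl _ _ b x)) _.
by apply: least; rewrite /= addrA sup.
Qed.

(** Regrouped, the estimator equation is affine in the estimate with matrix [A + L *m C], so its
    least solution is bounded by a star, hence by every supersolution. *)
Lemma estimate_le_supersolution (n p m : nat) (A : 'M[gseries]_n)
    (B : 'M[gseries]_(n, p)) (C : 'M[gseries]_(m, n)) (L : 'M[gseries]_(n, m))
    (u : 'cV[gseries]_p) (y : 'cV[gseries]_m) (x : 'cV[gseries]_n) :
  lemx (A *m x + B *m u + L *m (C *m x + y)) x ->
  lemx (estimate A B C L u y) x.
Proof.
have regroup z : A *m z + B *m u + L *m (C *m z + y) =
    (A + L *m C) *m z + (B *m u + L *m y).
  by rewrite mulmxDl mulmxDr mulmxA -!addrA [B *m u + (_ + _)]addrCA.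
rewrite regroup => /star_le_supersolution; apply: lemx_trans.
have [_] := estimate_least A B C L u y; apply; rewrite /estimate_eq regroup.
by have [] := star_least (A + L *m C) (B *m u + L *m y).
Qed.

Lemma estimate_le_state (n p m l : nat) (A : 'M[gseries]_n)
    (B : 'M[gseries]_(n, p)) (C : 'M[gseries]_(m, n)) (R : 'M[gseries]_(n, l))
    (L : 'M[gseries]_(n, m)) (u : 'cV[gseries]_p) (w : 'cV[gseries]_l) :
  let x := state A B R u w in
  lemx (estimate A B C L u (C *m x)) x <-> lemx (L *m (C *m x)) x.
Proof.
move=> x; split=> [le_x|LCx].
  apply: lemx_trans le_x.
  have [xhE _] := estimate_least A B C L u (C *m x).
  rewrite [X in lemx _ X]xhE; apply: lemx_trans (lemxDr _ _ _ _).
  exact: lemxM (lemxDr _ _ _ _).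
apply: estimate_le_supersolution.
have [xE _] := state_least A B R u w; rewrite /= -/x in xE.
(* With [y = C *m x] the correction term is [L *m (C *m x)] added to itself; the remaining terms are
   part of the state equation. *)
apply/lemxD; split; last by rewrite mulmxDr; apply/lemxD.
by rewrite [X in lemx _ X]xE; exact: lemxDl.
Qed.

Theorem proposition2 (n p m l : nat)
    (A : 'M[gseries]_n) (B : 'M[gseries]_(n, p))
    (C : 'M[gseries]_(m, n)) (R : 'M[gseries]_(n, l))
    (hB : col_selection B) (hR : col_selection R) (hC : row_selection C) :
  let L1 := rdivmx (star A *m B) (C *m star A *m B) in
  let L2 := rdivmx (star A *m R) (C *m star A *m R) in
  let Lx := meetmx L1 L2 in
  is_greatest
    [set L : 'M[gseries]_(n, m) |
      forall (u : 'cV[gseries]_p) (w : 'cV[gseries]_l),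
        let x := state A B R u w in
        let y := C *m x in
        lemx (estimate A B C L u y) x]
    Lx.
Proof.
move=> L1 L2 Lx; split=> [u w x y|L /= estL].
  apply/estimate_le_state.
  (* [Lx] lies below both residuals, hence satisfies both residual inequalities. *)
  have /lemx_meet[/lemx_rdiv le1 /lemx_rdiv le2] := lemx_refl Lx.
  rewrite /state !mulmxDr; apply: lemxDD.
    by have := lemxMr _ _ _ _ _ u le1; rewrite -!mulmxA.
  by have := lemxMr _ _ _ _ _ w le2; rewrite -!mulmxA.
have LCx u w := (estimate_le_state _ _ _ _ A B C R L u w).1 (estL u w).
apply/lemx_meet; split; apply/lemx_rdiv; apply: lemx_unit => v.
  by have := LCx v 0; rewrite /state mulmx0 addr0 -!mulmxA.
by have := LCx 0 v; rewrite /state mulmx0 add0r -!mulmxA.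
Qed.
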